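(* Let $2\le p<\infty$, $\sigma\in(1,2]$, let $Q\subset\mathbb{R}^n$ be a compact convex set whose interior is nonempty and contains zero, and let $\|\cdot\|$ be a norm on $\mathbb{R}^n$. Let $f\in\mathcal{F}^{\sigma}_{\|\cdot\|}(Q,L_\sigma)$ and let $\Psi:Q\to\mathbb{R}$ be $p$-uniformly convex with respect to $\|\cdot\|$. Setting $\delta=\varepsilon/T$ and $$M=\left[\frac2p\left(\frac{p-\sigma}{\sigma}\right)\frac1\delta\right]^{\frac{p-\sigma}{\sigma}}L_\sigma^{\frac p\sigma},$$ the accelerated method with Bregman prox described in the context, started at $x_0\in Q$, requires $$T<p\left[2^p\left(\frac{p-\sigma}{\sigma}\right)^{p-\sigma}\frac{D_\Psi(Q)^\sigma L_\sigma^p}{\varepsilon^p}\right]^{\frac{1}{(p+1)\sigma-p}}+1$$ iterations to reach an accuracy $\varepsilon>0$, i.e. $f(y_T)-\min_{x\in Q}f(x)\le\varepsilon$.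
   Context: Hölder class: $\mathcal{F}^{\sigma}_{\|\cdot\|}(Q,L_\sigma)$ is the set of convex functions $f:Q\to\mathbb{R}$ with $\|\nabla f(x)-\nabla f(y)\|_*\le L_\sigma\|x-y\|^{\sigma-1}$ for all $x,y\in Q$, where $\|\cdot\|_*$ is the dual norm. Uniform convexity: a subdifferentiable function $\Psi:Q\to\mathbb{R}$ is $p$-uniformly convex with constant $\mu>0$ w.r.t. $\|\cdot\|$ if $\Psi(y)\ge\Psi(x)+\langle\nabla\Psi(x),y-x\rangle+\frac{\mu}{p}\|y-x\|^p$ for all $x$ in the interior of $Q$ and all $y\in Q$. When the constant is not mentioned, $\mu=1$. Here $\nabla\Psi(x)$ denotes a subgradient of $\Psi$ at $x$. Constant of variation: $D_\Psi(Q)=\sup_{x\in Q}\Psi(x)-\inf_{x\in Q}\Psi(x)$. Bregman divergence: $V_x(y)=\Psi(y)-\langle\nabla\Psi(x),y-x\rangle-\Psi(x)$ for $x$ in the interior of $Q$ and $y\in Q$. Step sequence: $\gamma_1=1$ and, for $t\ge1$, $\gamma_{t+1}$ is the largest root of $\gamma_{t+1}^p=\gamma_{t+1}^{p-1}+\gamma_t^p$. Accelerated method with Bregman prox (input $x_0\in Q$; parameters $M$, $T$): set $y_0=x_0$, $z_0=x_0$, $A_0=0$. For $t=0,\ldots,T-1$: set $\alpha_{t+1}=\gamma_{t+1}^{p-1}/M$, $A_{t+1}=A_t+\alpha_{t+1}$, $\tau_t=\alpha_{t+1}/A_{t+1}$, $x_{t+1}=\tau_tz_t+(1-\tau_t)y_t$,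 obtain $\nabla f(x_{t+1})$, and update $$y_{t+1}=\arg\min_{y\in Q}\left\{\tfrac Mp\|y-x_{t+1}\|^p+\langle\nabla f(x_{t+1}),y-x_{t+1}\rangle\right\},$$ $$z_{t+1}=\arg\min_{z\in Q}\left\{V_{z_t}(z)+\alpha_{t+1}\langle\nabla f(x_{t+1}),z-z_t\rangle\right\}.$$ The output is $y_T$.
   Formalization: Added, since the claim fails otherwise: V_{x_0}(u) ≤ D_Ψ(Q) for all u in Q (true if x_0 minimizes Ψ and ∇Ψ(x_0)=0), and the subgradient of Ψ at z_{t+1} satisfies the first-order optimality condition of the step defining z_{t+1} (automatic if Ψ is differentiable). Also L_σ>0, n≥1. *)

(* Defs.v *)
From HB Require Import structures.
From mathcomp Require Import all_boot all_order all_algebra.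
From mathcomp Require Import all_classical all_reals all_analysis.
Import numFieldNormedType.Exports.

Set Implicit Arguments.
Unset Strict Implicit.
Unset Printing Implicit Defensive.

Import Order.TTheory GRing.Theory Num.Theory.

Local Open Scope classical_set_scope.
Local Open Scope ring_scope.

(* Functions on Q : set 'rV[R]_n are represented by total functions on
   'rV[R]_n; only their values on Q are ever used. Dual vectors are identified
   with row vectors through the standard pairing. The canonical norm of
   'rV[R]_n (the sup norm) is used only for its topology. *)

Definition dotp (R : realType) (n : nat) (g x : 'rV[R]_n) : R :=
  \sum_i g ord0 i * x ord0 i.

Record is_norm (R : realType) (n : nat) (N : 'rV[R]_n -> R) : Prop := IsNorm {
  norm_triangle : forall x y, N (x + y) <= N x + N y ;
  norm_scale : forall (a : R) x, N (a *: x) = `|a| * N x ;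
  norm_separates : forall x, N x = 0 -> x = 0 }.

Definition dual_norm (R : realType) (n : nat) (N : 'rV[R]_n -> R)
    (g : 'rV[R]_n) : R :=
  sup [set dotp g x | x in [set x | N x <= 1]].

(* Fréchet gradient relative to Q, so that boundary points are covered; it is
   unique when Q is convex with nonempty interior. *)
Definition gradient_on (R : realType) (n : nat) (Q : set 'rV[R]_n)
    (f : 'rV[R]_n -> R) (df : 'rV[R]_n -> 'rV[R]_n) : Prop :=
  forall x, Q x ->
    (fun y => f y - f x - dotp (df x) (y - x) : R^o)
      =o_ (within Q (nbhs x)) (fun y => y - x).

Definition holder_class (R : realType) (n : nat) (N : 'rV[R]_n -> R)
    (Q : set 'rV[R]_n) (sigma L : R)
    (f : 'rV[R]_n -> R) (df : 'rV[R]_n -> 'rV[R]_n) : Prop :=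
  [/\ convex_function (Q : set (convex_lmodType 'rV[R]_n)) f,
      gradient_on Q f df &
      forall x y, Q x -> Q y ->
        dual_norm N (df x - df y) <= L * N (x - y) `^ (sigma - 1)].

Definition subgradient (R : realType) (n : nat) (Q : set 'rV[R]_n)
    (Psi : 'rV[R]_n -> R) (x g : 'rV[R]_n) : Prop :=
  forall y, Q y -> Psi x + dotp g (y - x) <= Psi y.

Definition uniformly_convex (R : realType) (n : nat) (N : 'rV[R]_n -> R)
    (Q : set 'rV[R]_n) (p mu : R) (Psi : 'rV[R]_n -> R) : Prop :=
  (forall x, Q^° x -> exists g, subgradient Q Psi x g) /\
  (forall x g y, Q^° x -> subgradient Q Psi x g -> Q y ->
     Psi x + dotp g (y - x) + mu / p * N (y - x) `^ p <= Psi y).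

(* Extended-real, because a convex function on a compact set may be unbounded
   above near the boundary. *)
Definition variation_constant (R : realType) (n : nat) (Q : set 'rV[R]_n)
    (Psi : 'rV[R]_n -> R) : \bar R :=
  (ereal_sup [set (Psi x)%:E | x in Q] - ereal_inf [set (Psi x)%:E | x in Q])%E.

(* [g] is the subgradient of Psi at x written nabla Psi(x). The initial point
   x0 of the method has to satisfy V_{x0}(u) <= D_Psi(Q) for all u in Q; this
   holds when x0 minimizes Psi over Q and g = 0. For Psi(x) = x^2/2 on
   [-1, 1] and x0 near -1 it fails, and so does the iteration bound. *)
Definition bregman (R : realType) (n : nat) (Psi : 'rV[R]_n -> R)
    (g x y : 'rV[R]_n) : R :=
  Psi y - dotp g (y - x) - Psi x.

Definition is_argmin (R : realType) (n : nat) (Q : set 'rV[R]_n)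
    (h : 'rV[R]_n -> R) (x : 'rV[R]_n) : Prop :=
  Q x /\ forall y, Q y -> h x <= h y.

Definition is_largest_root (R : realType) (p c r : R) : Prop :=
  let root s := 0 <= s /\ s `^ p = s `^ (p - 1) + c `^ p in
  root r /\ forall s, root s -> s <= r.

(* The sequence starts at index 1; the value at 0 is irrelevant. *)
Definition step_sequence (R : realType) (p : R) (gam : nat -> R) : Prop :=
  gam 1%N = 1 /\
  forall t, (1 <= t)%N -> is_largest_root p (gam t) (gam t.+1).

Definition alpha (R : realType) (p M : R) (gam : nat -> R) (t : nat) : R :=
  gam t `^ (p - 1) / M.

Fixpoint alpha_sum (R : realType) (p M : R) (gam : nat -> R) (t : nat) : R :=
  if t is s.+1 then alpha_sum p M gam s + alpha p M gam s.+1 else 0.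

Definition tau (R : realType) (p M : R) (gam : nat -> R) (t : nat) : R :=
  alpha p M gam t.+1 / alpha_sum p M gam t.+1.

(* [g t] is the subgradient nabla Psi(z_t) used in the Bregman divergence
   V_{z_t}. When Psi is not differentiable at z_{t+1}, "a subgradient" has to
   mean one for which the first-order optimality condition of the step that
   defines z_{t+1} holds ([run_opt]); with an arbitrary selection the method
   need not converge at the stated rate. If Psi is differentiable at an
   interior point z_{t+1}, [run_opt] follows from [run_z]; in all cases
   g t - alpha_{t+1} df(x_{t+1}) is a subgradient satisfying it. *)
Record accelerated_run (R : realType) (n : nat) (N : 'rV[R]_n -> R)
    (Q : set 'rV[R]_n) (p M : R) (gam : nat -> R)
    (df : 'rV[R]_n -> 'rV[R]_n) (Psi : 'rV[R]_n -> R) (T : nat)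
    (x0 g0 : 'rV[R]_n) (x y z g : nat -> 'rV[R]_n) : Prop := AcceleratedRun {
  run_y0 : y 0%N = x0 ;
  run_z0 : z 0%N = x0 ;
  run_g0 : g 0%N = g0 ;
  run_g : forall t, (t < T)%N -> subgradient Q Psi (z t) (g t) ;
  run_x : forall t, (t < T)%N ->
    x t.+1 = tau p M gam t *: z t + (1 - tau p M gam t) *: y t ;
  run_y : forall t, (t < T)%N ->
    is_argmin Q (fun u => M / p * N (u - x t.+1) `^ p
                          + dotp (df (x t.+1)) (u - x t.+1)) (y t.+1) ;
  run_z : forall t, (t < T)%N ->
    is_argmin Q (fun u => bregman Psi (g t) (z t) u
                   + alpha p M gam t.+1 * dotp (df (x t.+1)) (u - z t))
              (z t.+1) ;
  run_opt : forall t, (t.+1 < T)%N -> forall u, Q u ->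
    0 <= dotp (g t.+1 - g t + alpha p M gam t.+1 *: df (x t.+1)) (u - z t.+1) }.

(* Here 0 `^ 0 = 1, which is the convention needed when p = sigma = 2. *)
Definition prox_parameter (R : realType) (p sigma L delta : R) : R :=
  (2 / p * ((p - sigma) / sigma) * (1 / delta)) `^ ((p - sigma) / sigma)
  * L `^ (p / sigma).

Definition iteration_bound (R : realType) (p sigma L eps : R) (D : \bar R)
  : \bar R :=
  (p%:E * ((2 `^ p * ((p - sigma) / sigma) `^ (p - sigma))%:E
           * (D `^ sigma * (L `^ p / eps `^ p)%:E))
          `^ (1 / ((p + 1) * sigma - p))
   + 1)%E.

(* Main.v *)
Require Import Defs.
From HB Require Import structures.
From mathcomp Require Import all_boot all_order all_algebra.
From mathcomp Require Import all_classical all_reals all_analysis.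
From mathcomp Require Import ring lra.
Import numFieldNormedType.Exports.
Import Order.TTheory GRing.Theory Num.Theory.

(** The method is an inexact accelerated scheme, and its analysis has three
    ingredients.

    Smoothing. The Hölder gradient gives
    [f u <= f x + <df x, u - x> + L / sigma * N (u - x)^sigma]
    ([holder_upper_bound]), and Young's inequality trades the power [sigma] for
    the power [p] at the price of an additive error: the last term is at most
    [M / p * N (u - x)^p + delta / 2], where [M] is exactly the proximal
    parameter ([holder_le_prox]).

    Coupling. The step sequence makes the weights satisfy [M * A_t = gamma_t^p]
    and [tau_t = 1 / gamma_(t+1)], hence [A_(t+1) * M * tau_t^p = 1]. In the
    comparison of the gradient step with the point obtained from the mirror
    step, the term in the [p]-th power of the norm is therefore at most one
    Bregman divergence, by uniform convexity of [Psi] ([accelerated_step]). The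
    mirror iterates may reach the boundary of [Q], so uniform convexity is first
    extended from interior points to all points of [Q] with a subgradient
    ([uniformly_convex_boundary]). Bregman divergences telescope, the weights
    increase, and with [T * delta = eps] this yields
    [f (y_T) - f u <= V_(x0)(u) / A_T + eps / 2] ([accelerated_rate]).

    Counting. The tangent inequality for the power [p] shows that consecutive
    terms of the step sequence differ by at least [1 / p] ([step_increment]), so
    that [A_T >= (T / p)^p / M]. The parameter [M] grows with [T] only like
    [T^((p - sigma) / sigma)], and solving [V * M <= eps / 2 * (T / p)^p] for
    [T] gives the threshold of the iteration bound ([iteration_count]); the
    least integer not below it is the number of iterations. The threshold is
    positive because the variation of [Psi] is ([variation_constant_gt0]). *)

Set Implicit Arguments.
Unset Strict Implicit.
Unset Printing Implicit Defensive.

Local Open Scope classical_set_scope.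
Local Open Scope ring_scope.

(** * Norms and the dual pairing *)

Section Pairing.
Context {R : realType} {n : nat}.
Implicit Types g x y : 'rV[R]_n.

Lemma dotpDl g h x : dotp (g + h) x = dotp g x + dotp h x.
Proof.
by rewrite /dotp -big_split; apply: eq_bigr => i _; rewrite mxE mulrDl.
Qed.

Lemma dotpZl a g x : dotp (a *: g) x = a * dotp g x.
Proof.
by rewrite /dotp mulr_sumr; apply: eq_bigr => i _; rewrite mxE mulrA.
Qed.

Lemma dotpNl g x : dotp (- g) x = - dotp g x.
Proof. by rewrite -scaleN1r dotpZl mulN1r. Qed.

Lemma dotpDr g x y : dotp g (x + y) = dotp g x + dotp g y.
Proof.
by rewrite /dotp -big_split; apply: eq_bigr => i _; rewrite mxE mulrDr.
Qed.

Lemma dotpZr a g x : dotp g (a *: x) = a * dotp g x.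
Proof.
by rewrite /dotp mulr_sumr; apply: eq_bigr => i _; rewrite mxE mulrCA.
Qed.

Lemma dotpNr g x : dotp g (- x) = - dotp g x.
Proof. by rewrite -scaleN1r dotpZr mulN1r. Qed.

Lemma coord_le_norm x i : `|x ord0 i| <= `|x|.
Proof.
rewrite [leRHS]/Num.norm /= mx_normrE; apply/bigmax_geP; right => /=.
by exists (ord0, i).
Qed.

Lemma dotp_le g x : `|dotp g x| <= (\sum_i `|g ord0 i|) * `|x|.
Proof.
rewrite /dotp mulr_suml (le_trans (ler_norm_sum _ _ _))//.
by apply: ler_sum => i _; rewrite normrM ler_wpM2l// coord_le_norm.
Qed.

End Pairing.

Section Norm.
Context {R : realType} {n : nat} (N : 'rV[R]_n -> R) (hN : is_norm N).
Implicit Types g x y : 'rV[R]_n.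

Lemma normN0 : N 0 = 0.
Proof. by rewrite -(scale0r 0) (norm_scale hN) normr0 mul0r. Qed.

Lemma normNN x : N (- x) = N x.
Proof. by rewrite -scaleN1r (norm_scale hN) normrN1 mul1r. Qed.

Lemma normN_ge0 x : 0 <= N x.
Proof.
have := norm_triangle hN x (- x); rewrite subrr normN0 normNN.
by rewrite -mulr2n pmulrn_lge0.
Qed.

Lemma normN_gt0 x : x != 0 -> 0 < N x.
Proof.
move=> x0; rewrite lt_neqAle normN_ge0 andbT eq_sym.
by apply: contra_neq x0; exact: norm_separates.
Qed.

Lemma normN_sum (I : finType) (F : I -> 'rV[R]_n) :
  N (\sum_i F i) <= \sum_i N (F i).
Proof.
apply: (big_ind2 (fun v r => N v <= r)) => //; first by rewrite normN0.
by move=> v1 r1 v2 r2 h1 h2; rewrite (le_trans (norm_triangle hN _ _))// lerD.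
Qed.

Lemma normN_le : exists2 C, 0 < C & forall x, N x <= C * `|x|.
Proof.
exists (\sum_i N (delta_mx ord0 i) + 1).
  by rewrite ltr_wpDl// sumr_ge0// => i _; exact: normN_ge0.
move=> x; rewrite {1}(row_sum_delta x) (le_trans (normN_sum _))//.
rewrite mulrDl mul1r ler_wpDr// mulr_suml ler_sum// => i _.
by rewrite (norm_scale hN) mulrC ler_wpM2l ?normN_ge0// coord_le_norm.
Qed.

Lemma normN_continuous : continuous N.
Proof.
have [C C0 NC] := normN_le => x.
have Fx : Filter (nbhs x) by exact: nbhs_filter.
apply/(@cvgrPdist_le _ _ _ (nbhs x) Fx) => e e0.
have h u v : N u - N v <= N (u - v).
  by rewrite lerBlDr -{1}(subrK v u) (norm_triangle hN).
have hxy y : `|N x - N y| <= N (x - y).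
  rewrite ler_norml; apply/andP; split; last exact: h.
  by rewrite lerNl (opprB (N x)) -(normNN (x - y)) (opprB x) h.
have /cvgrPdist_le/(_ (C^-1 * e)) : y @[y --> x] --> x by exact: cvg_id.
rewrite mulr_gt0 ?invr_gt0// => /(_ isT); apply: filterS => y xy.
by rewrite (le_trans (hxy y))// (le_trans (NC _))// -ler_pdivlMl.
Qed.

(** Compactness of the unit sphere of the sup norm turns the separation axiom
    into a quantitative lower bound. *)
Lemma normN_ge : exists2 c, 0 < c & forall x, c * `|x| <= N x.
Proof.
pose S := [set x : 'rV[R]_n | `|x| = 1].
have [[s Ss]|noS] := pselect (S !=set0); last first.
  exists 1 => // x; rewrite mul1r; have [->|x0] := eqVneq x 0.
    by rewrite normr0 normN_ge0.
  exfalso; apply: noS; exists (`|x|^-1 *: x).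
  by rewrite /S /= normrZ normfV normr_id mulVf// normr_eq0.
have cS : compact S.
  apply: bounded_closed_compact.
    by exists 1; split=> // M M1 x /= ->; exact: ltW.
  apply: (@closed_comp _ _ (fun x : 'rV[R]_n => `|x|) [set 1 : R]).
    by move=> x _; exact: norm_continuous.
  exact: closed_eq.
have [c /[!inE] Sc cmin] : exists2 c, c \in S & forall t, t \in S -> N c <= N t.
  apply: EVT_min_rV => //; first by exists s.
  exact/continuous_subspaceT/normN_continuous.
have c0 : c != 0 by apply/eqP => c0; move: Sc; rewrite /S /= c0 normr0; lra.
exists (N c); first exact: normN_gt0.
move=> x; have [->|x0] := eqVneq x 0; first by rewrite normr0 mulr0 normN_ge0.
have nx : 0 < `|x| by rewrite normr_gt0.
have /cmin : `|x|^-1 *: x \in S.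
  by rewrite inE /S /= normrZ normfV normr_id mulVf// gt_eqF.
by rewrite (norm_scale hN) normfV normr_id ler_pdivlMl// mulrC.
Qed.

(** The supremum defining the dual norm is a genuine one because the unit ball
    of [N] is bounded. *)
Lemma dotp_le_dual g x : dotp g x <= dual_norm N g * N x.
Proof.
have [c c0 Nc] := normN_ge.
have [->|x0] := eqVneq x 0.
  by rewrite normN0 mulr0 -(scale0r 0) dotpZr mul0r.
have Nx := normN_gt0 x0; rewrite -ler_pdivrMr// mulrC -dotpZr.
apply: ub_le_sup; last first.
  exists ((N x)^-1 *: x) => //=.
  by rewrite (norm_scale hN) ger0_norm ?invr_ge0 ?normN_ge0// mulVf// gt_eqF.
exists ((\sum_i `|g ord0 i|) * c^-1) => _ [v /= Nv <-].
rewrite (le_trans (ler_norm _))// (le_trans (dotp_le _ _))//.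
rewrite ler_wpM2l ?sumr_ge0// -[c^-1]mulr1 ler_pdivlMl//.
exact: le_trans (Nc _) _.
Qed.

End Norm.

(** * Gradients relative to a convex set *)

Section Segments.
Context {R : realType} {n : nat}.
Variable Q : set 'rV[R]_n.
Hypothesis Qconvex : convex_set (Q : set (convex_lmodType 'rV[R]_n)).
Implicit Types (x y : 'rV[R]_n) (s : R).

Let seg x y s (s0 : 0 <= s) (s1 : s <= 1) :
  (conv (Itv01 s0 s1) (y : convex_lmodType _) (x : convex_lmodType _))
  = x + s *: (y - x).
Proof.
transitivity (s *: y + (1 - s) *: x : 'rV[R]_n) => //.
by apply/rowP => i; rewrite !mxE; ring.
Qed.

Lemma segment_in x y s : Q x -> Q y -> 0 <= s <= 1 -> Q (x + s *: (y - x)).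
Proof.
move=> Qx Qy /andP[s0 s1]; rewrite -(seg x y s0 s1).
by apply/set_mem/Qconvex; exact: mem_set.
Qed.

Lemma convex_segment (f : 'rV[R]_n -> R) x y s :
  convex_function (Q : set (convex_lmodType 'rV[R]_n)) f ->
  Q x -> Q y -> 0 <= s <= 1 -> f (x + s *: (y - x)) <= f x + s * (f y - f x).
Proof.
move=> fconv Qx Qy /andP[s0 s1]; rewrite -(seg x y s0 s1).
have -> : f x + s * (f y - f x) = s * f y + (1 - s) * f x by ring.
by apply: (fconv (Itv01 s0 s1)); exact: mem_set.
Qed.

(** All that is used of a gradient relative to [Q] is its restriction to the
    segments of [Q], where it becomes a one-variable statement. The base point
    may be an end of the segment, so [s] is confined to [[0, 1]]. *)
Lemma gradient_segment (f : 'rV[R]_n -> R) df x y s0 e :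
  gradient_on Q f df -> Q x -> Q y -> 0 <= s0 <= 1 -> 0 < e ->
  exists2 d, 0 < d & forall s, 0 <= s <= 1 -> `|s - s0| < d ->
    `|f (x + s *: (y - x)) - f (x + s0 *: (y - x))
      - (s - s0) * dotp (df (x + s0 *: (y - x))) (y - x)| <= e * `|s - s0|.
Proof.
move=> fdf Qx Qy s01 e0; set v := y - x; set w := x + s0 *: v.
have Qw : Q w by exact: segment_in.
have v0 : 0 < `|v| + 1 by rewrite ltr_wpDl.
move: (fdf w Qw) => /eqoP /(_ (e / (`|v| + 1))).
rewrite divr_gt0// => /(_ isT).
rewrite near_withinE => /nbhs_ballP[d /= d0 dP].
exists (d / (`|v| + 1)); first by rewrite divr_gt0.
move=> s s01' sd; have vE : x + s *: v - w = (s - s0) *: v.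
  by rewrite /w opprD addrACA subrr add0r scalerBl.
have := dP (x + s *: v); rewrite -ball_normE /= -opprB vE normrN normrZ dotpZr.
rewrite -[X in _ -> _ -> `|X| <= _]
  /(f (x + s *: v) - f w - (s - s0) * dotp (df w) v).
have h : `|s - s0| * `|v| <= `|s - s0| * (`|v| + 1).
  by rewrite ler_wpM2l// lerDl.
move=> /(_ _ _)/le_trans; apply.
- by rewrite (le_lt_trans h)// -ltr_pdivlMr.
- exact: segment_in.
- by rewrite mulrAC ler_pdivrMr// -mulrA ler_wpM2l// ltW.
Qed.

(** The convexity inequality at a point close to [x] on the segment to [y],
    divided by the distance covered. *)
Lemma gradient_le (f : 'rV[R]_n -> R) df x y :
  convex_function (Q : set (convex_lmodType 'rV[R]_n)) f ->
  gradient_on Q f df -> Q x -> Q y ->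
  f x + dotp (df x) (y - x) <= f y.
Proof.
move=> fconv fdf Qx Qy; apply/ler_addgt0Pr => e e0.
have [|d d0 dP] := @gradient_segment f df x y 0 e fdf Qx Qy _ e0.
  by rewrite lexx ler01.
pose s := Num.min 1 (d / 2).
have s0 : 0 < s by rewrite lt_min ltr01 divr_gt0.
have s1 : 0 <= s <= 1 by rewrite ltW//= ge_min lexx.
have sd : `|s - 0| < d.
  by rewrite subr0 gtr0_norm// gt_min; apply/orP; right; lra.
have := dP s s1 sd; rewrite subr0 scale0r addr0 (gtr0_norm s0) => h.
have := convex_segment fconv Qx Qy s1.
move: h; rewrite ler_norml => /andP[h _] h'.
have : s * (f x + dotp (df x) (y - x)) <= s * (f y + e) by lra.
by rewrite ler_pM2l.
Qed.

Lemma gradient_continuous (f : 'rV[R]_n -> R) df :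
  gradient_on Q f df -> {within Q, continuous f}.
Proof.
move=> fdf; apply/subspace_continuousP => w Qw.
have Fw : Filter (within Q (nbhs w)).
  exact: (@within_filter _ Q (nbhs w) (nbhs_filter w)).
apply/(@cvgrPdist_le _ _ _ _ Fw) => e e0.
pose K := \sum_i `|df w ord0 i| + 1.
have K0 : 0 < K by rewrite ltr_wpDl ?sumr_ge0.
move: (fdf w Qw) => /eqoP /(_ 1 ltr01).
rewrite !near_withinE => /nbhs_ballP[d /= d0 dP].
apply/nbhs_ballP; exists (Num.min d (e / K)) => /=.
  by rewrite lt_min d0 divr_gt0.
move=> y; rewrite -ball_normE /= lt_min => /andP[yd ye] Qy.
have := dP y; rewrite -ball_normE /= mul1r => /(_ yd Qy).
rewrite -[X in `|X| <= _]/(f y - f w - dotp (df w) (y - w)) => h.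
have := dotp_le (df w) (y - w); rewrite distrC in ye.
have : K * `|y - w| <= e by rewrite -ler_pdivlMl// mulrC ltW.
rewrite /K mulrDl mul1r.
move: h; set u := _ - dotp _ _; move=> h1 h2 h3.
rewrite distrC -(subrK (dotp (df w) (y - w)) (f y - f w)) -/u.
by rewrite (le_trans (ler_normD _ _))//; lra.
Qed.

End Segments.

Section Taylor.
Context {R : realType} {n : nat}.
Variables (N : 'rV[R]_n -> R) (Q : set 'rV[R]_n).
Hypothesis hN : is_norm N.
Hypothesis Qconvex : convex_set (Q : set (convex_lmodType 'rV[R]_n)).
Implicit Types (x y : 'rV[R]_n) (s : R).

Lemma gradient_is_derive (f : 'rV[R]_n -> R) df x y s :
  gradient_on Q f df -> Q x -> Q y -> 0 < s < 1 ->
  is_derive s 1 (fun r : R => f (x + r *: (y - x)))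
    (dotp (df (x + s *: (y - x))) (y - x)).
Proof.
move=> fdf Qx Qy /andP[s0 s1]; set l := dotp _ _; set phi := fun r : R => _.
have cv : h^-1 *: (phi (h *: (1 : R) + s) - phi s) @[h --> 0^'] --> l.
  apply/cvgrPdist_le => e e0.
  have s01 : 0 <= s <= 1 by rewrite !ltW.
  have [d d0 dP] := gradient_segment Qconvex fdf Qx Qy s01 e0.
  pose r := Num.min d (Num.min s (1 - s)).
  have r0 : 0 < r by rewrite !lt_min d0 s0 subr_gt0.
  rewrite near_withinE; apply/nbhs_ballP; exists r => // h.
  rewrite -ball_normE /= sub0r normrN !lt_min => /and3P[hd hs hs1] h0.
  have hn0 : 0 < `|h| by rewrite normr_gt0.
  have := dP (h + s); rewrite addrK.
  have -> : 0 <= h + s <= 1.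
    by move: (ler_norm h) (ler_norm (- h)); rewrite normrN => ? ?; lra.
  move=> /(_ isT hd).
  rewrite -/phi -/l -[f (x + (h + s) *: _)]/(phi (h + s)).
  rewrite -[f (x + s *: _)]/(phi s) => H.
  rewrite -(ler_pM2l hn0) -normrM mulrC [leRHS]mulrC.
  have -> : h *: (1 : R) = h by rewrite /GRing.scale /= mulr1.
  rewrite mulrBl -[_ *: _]/(h^-1 * (phi (h + s) - phi s)) mulrAC mulVf//.
  by rewrite mul1r distrC [l * h]mulrC.
split; first by apply/cvg_ex; exists l; exact: cv.
exact: (cvg_lim (@Rhausdorff R) cv).
Qed.

(** Integrating the Hölder bound of the gradient along the segment from [x] to
    [y]: the function [h] below is, up to the constant [f x], the gap between
    the two sides at the point of parameter [r], and its derivative is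
    nonpositive. The two ends are approached from inside, because the gradient
    is only one-sided there. *)
Lemma holder_upper_bound (f : 'rV[R]_n -> R) df (sigma L : R) x y :
  1 < sigma -> 0 < L -> holder_class N Q sigma L f df -> Q x -> Q y ->
  f y <= f x + dotp (df x) (y - x) + L / sigma * N (y - x) `^ sigma.
Proof.
move=> sigma1 L0 [fconv fdf fL] Qx Qy.
have sigma0 : 0 < sigma by lra.
set v := y - x; set c := dotp (df x) v; set K := L / sigma * N v `^ sigma.
have K0 : 0 <= K by rewrite mulr_ge0 ?powR_ge0// divr_ge0// ltW.
pose phi := fun r : R => f (x + r *: v).
pose h := fun r : R => phi r - r * c - K * r `^ sigma.
have dh (r : R) : r \in `]0, 1[%R ->
    is_derive r 1 h
      (dotp (df (x + r *: v)) v - c - K * (sigma * r `^ (sigma - 1))).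
  rewrite in_itv /= => /[dup] r01 /andP[r0 r1].
  have d1 := gradient_is_derive fdf Qx Qy r01.
  have d2 := is_derive1_powR sigma r0.
  have d3 : is_derive r 1 (fun r : R => r * c) c.
    have -> : (fun r : R => r * c) = c \*: (@id R).
      by apply/funext => z; rewrite /= mulrC.
    by apply: is_derive_eq; rewrite /GRing.scale /= mulr1.
  have d4 := is_deriveZ K d2.
  exact: is_deriveB (is_deriveB d1 d3) d4.
have hmono : {in `]0, 1[%R &, {homo h : s t /~ s <= t}}.
  apply: ler0_derive1_le_oo => r r01.
  - by have [] := dh r r01.
  - rewrite derive1E; have [_ ->] := dh r r01.
    have Qr : Q (x + r *: v).
      by apply: segment_in => //; move: r01; rewrite in_itv /=; lra.
    move: r01; rewrite in_itv /= => /andP[r0 r1].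
    have -> : dotp (df (x + r *: v)) v - c = dotp (df (x + r *: v) - df x) v.
      by rewrite dotpDl dotpNl.
    rewrite subr_le0 (le_trans (dotp_le_dual hN _ _))//.
    rewrite (le_trans (ler_wpM2r (normN_ge0 hN _) (fL _ _ Qr Qx)))//.
    rewrite addrC addKr (norm_scale hN) (gtr0_norm r0).
    rewrite powRM ?(normN_ge0 hN) ?(ltW r0)// -mulrA -mulrA [_ * N v]mulrC.
    rewrite mulr_powRB1 ?(normN_ge0 hN)//.
    have -> : K * (sigma * r `^ (sigma - 1))
        = L * (r `^ (sigma - 1) * N v `^ sigma).
      by rewrite /K; field; rewrite gt_eqF.
    by [].
  - move: r01; rewrite inE /= => r01.
    apply: differentiable_continuous; apply/derivable1_diffP.
    by have [] := dh r r01.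
have [|d0 d00 dP0] := gradient_segment (s0 := 0) Qconvex fdf Qx Qy _ ltr01.
  by rewrite lexx ler01.
have [|d1 d10 dP1] := gradient_segment (s0 := 1) Qconvex fdf Qx Qy _ ltr01.
  by rewrite lexx ler01.
apply/ler_addgt0Pr => e e0.
set b := dotp (df (x + 1 *: (y - x))) (y - x) in dP1.
(* Moving inside by [r] costs [r] for the error of the expansion at either end
   and [r * (b - c)] for the difference of the slopes there. *)
pose W := 1 + `|b - c| + 1.
have W0 : 0 < W by rewrite /W; have := normr_ge0 (b - c); lra.
pose r := Num.min (2^-1) (Num.min (d0 / 2) (Num.min (d1 / 2) (e / W))).
have [r0 r2 rd0 rd1 rW] :
    [/\ 0 < r, r <= 2^-1, r < d0, r < d1 & r * W <= e].
  rewrite -ler_pdivlMr// !lt_min !gt_min !ge_min !lexx !orbT.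
  rewrite !divr_gt0// invr_gt0 ltr0n /=; split=> //.
    by apply/orP; right; apply/orP; left; lra.
  by apply/orP; right; apply/orP; right; apply/orP; left; lra.
have r01 : 0 <= r <= 1 by lra.
have r01' : 0 <= 1 - r <= 1 by lra.
have := dP0 r r01; rewrite subr0 scale0r addr0 (gtr0_norm r0) => /(_ rd0).
rewrite -/v -/c mul1r -[f (x + _)]/(phi r) => H0.
have := dP1 (1 - r) r01'.
rewrite addrAC subrr add0r normrN (gtr0_norm r0) => /(_ rd1).
rewrite mul1r -/v scale1r subrKC -[f (x + _)]/(phi (1 - r)) => H1.
have : h (1 - r) <= h r by apply: hmono; rewrite ?in_itv/=; lra.
rewrite /h => Hh.
have P1 : K * (1 - r) `^ sigma <= K.
  rewrite -[leRHS]mulr1 ler_wpM2l//.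
  have := @ge0_ler_powR _ sigma (ltW sigma0) (1 - r) 1.
  by rewrite powR1 !nnegrE; apply; lra.
have P0 : 0 <= K * r `^ sigma by rewrite mulr_ge0// powR_ge0.
move: H0 H1; rewrite !ler_norml => /andP[_ H0] /andP[H1 _].
have Hb : r * b - r * c <= r * `|b - c|.
  by rewrite -mulrBr ler_wpM2l ?(ltW r0)// ler_norm.
by move: rW; rewrite /W !mulrDr; lra.
Qed.

End Taylor.

(** * Power inequalities and the step sequence *)

Section PowerTangent.
Context {R : realType}.

(** The graph of the convex power [c |-> c^p] lies above its tangent at [r];
    this is Young's inequality for [c] and [r^(p-1)]. *)
Lemma powR_tangent (p c r : R) : 1 < p -> 0 <= c -> 0 <= r ->
  p * c * r `^ (p - 1) <= c `^ p + (p - 1) * r `^ p.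
Proof.
move=> p1 c0 r0; have p0 : 0 < p by lra.
have q0 : 0 < p - 1 by lra.
have := @conjugate_powR _ c (r `^ (p - 1)) p (p / (p - 1)) c0 (powR_ge0 _ _).
rewrite divr_gt0// p0 => /(_ isT isT).
have -> : p^-1 + (p / (p - 1))^-1 = 1 by field; rewrite !gt_eqF.
move=> /(_ erefl); rewrite -powRrM.
have -> : (p - 1) * (p / (p - 1)) = p by field; rewrite gt_eqF.
rewrite -(ler_pM2l p0) mulrA => /le_trans; apply.
rewrite le_eqVlt; apply/orP; left; apply/eqP.
by field; rewrite !gt_eqF.
Qed.

End PowerTangent.

Section Smoothing.
Context {R : realType}.
Implicit Types p sigma L delta r : R.

Lemma prox_parameter_gt0 p sigma L delta :
  0 < L -> 0 < delta -> 0 < p -> 0 < sigma <= p ->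
  0 < prox_parameter p sigma L delta.
Proof.
move=> L0 d0 p0 /andP[s0]; rewrite le_eqVlt => /predU1P[<-|sp].
  by rewrite /prox_parameter subrr mul0r powRr0 mul1r powR_gt0.
rewrite /prox_parameter mulr_gt0 ?powR_gt0// mulr_gt0 ?divr_gt0//.
by rewrite mulr_gt0 ?divr_gt0// subr_gt0.
Qed.

(** Young's inequality with conjugate exponents [p / sigma] and
    [p / (p - sigma)]. The weight [b] is chosen so that its term equals
    [delta / 2]; the coefficient of [r^p] is then forced, and it comes out as
    the proximal parameter divided by [p]. *)
Lemma holder_le_prox p sigma L delta r :
  0 < L -> 0 < delta -> 0 < sigma <= p -> 0 <= r ->
  L / sigma * r `^ sigma
  <= prox_parameter p sigma L delta / p * r `^ p + delta / 2.
Proof.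
move=> L0 d0 /andP[s0]; rewrite le_eqVlt => /predU1P[<- r0|sp r0].
  rewrite /prox_parameter subrr mul0r powRr0 mul1r divff ?gt_eqF//.
  by rewrite powRr1 ?(ltW L0)// lerDl divr_ge0// ltW.
have p0 : 0 < p by lra.
have ps0 : 0 < p - sigma by lra.
pose w := p / (p - sigma); have w0 : 0 < w by rewrite divr_gt0.
pose b := (delta * w / 2) `^ w^-1.
have b0 : 0 < b by rewrite powR_gt0// divr_gt0// mulr_gt0.
pose c := L / (sigma * b); have c0 : 0 < c by rewrite divr_gt0// mulr_gt0.
have cr0 : 0 <= c * r `^ sigma by rewrite mulr_ge0 ?powR_ge0// ltW.
have := @conjugate_powR _ (c * r `^ sigma) b (p / sigma) w cr0 (ltW b0).
rewrite divr_gt0// w0 => /(_ isT isT).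
have -> : (p / sigma)^-1 + w^-1 = 1.
  by rewrite /w; field; rewrite !gt_eqF.
move=> /(_ erefl).
have -> : c * r `^ sigma * b = L / sigma * r `^ sigma.
  by rewrite /c; field; rewrite !gt_eqF.
have -> : b `^ w / w = delta / 2.
  rewrite /b -powRrM mulVf ?gt_eqF// powRr1; last first.
    by rewrite divr_ge0// mulr_ge0// ltW.
  by field; rewrite gt_eqF.
suff -> : (c * r `^ sigma) `^ (p / sigma) / (p / sigma)
          = prox_parameter p sigma L delta / p * r `^ p by [].
rewrite powRM ?powR_ge0 ?(ltW c0)// -powRrM.
have -> : sigma * (p / sigma) = p by field; rewrite gt_eqF.
suff cM : c `^ (p / sigma) * sigma = prox_parameter p sigma L delta.
  by rewrite -cM; field; rewrite !gt_eqF.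
have M0 : 0 < prox_parameter p sigma L delta.
  by rewrite prox_parameter_gt0// s0 ltW.
have cs0 : 0 < c `^ (p / sigma) * sigma by rewrite mulr_gt0 ?powR_gt0.
apply: ln_inj; rewrite ?posrE//.
have lnw : ln (delta * w / 2) = ln delta + (ln p - ln (p - sigma)) - ln 2.
  by rewrite ln_div ?posrE ?(mulr_gt0 d0 w0)// lnM ?posrE// ln_div ?posrE.
have sb0 : 0 < sigma * b by rewrite mulr_gt0.
have lnc : ln c = ln L - (ln sigma + w^-1 * ln (delta * w / 2)).
  rewrite /c (@ln_div _ L (sigma * b)) ?posrE// (@lnM _ sigma b) ?posrE//.
  by rewrite ln_powR.
have lnP : ln (2 / p * ((p - sigma) / sigma) * (1 / delta))
    = (ln 2 - ln p) + (ln (p - sigma) - ln sigma) - ln delta.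
  rewrite mul1r ln_div ?posrE ?mulr_gt0 ?invr_gt0//.
  by rewrite lnM ?posrE ?divr_gt0// !ln_div ?posrE.
have P0 : 0 < 2 / p * ((p - sigma) / sigma) * (1 / delta).
  by rewrite !mulr_gt0 ?invr_gt0.
rewrite lnM ?posrE ?(powR_gt0 _ c0)// ln_powR lnc lnw.
rewrite /prox_parameter lnM ?posrE ?powR_gt0// !ln_powR lnP /w.
by field; rewrite !gt_eqF.
Qed.

End Smoothing.

Section StepSequence.
Context {R : realType}.
Variables (p : R) (gam : nat -> R).
Hypotheses (hp : 1 < p) (hgam : step_sequence p gam).

Let p0 : 0 < p. Proof. exact: lt_trans ltr01 hp. Qed.
Let p1 : 0 < p - 1. Proof. by rewrite subr_gt0. Qed.

Lemma step_gt0 t : 0 < gam t.+1.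
Proof.
elim: t => [|t IH]; first by rewrite hgam.1.
have [[r0 rE] _] := hgam.2 t.+1 isT; rewrite lt_neqAle r0 andbT eq_sym.
apply/eqP => g0;
move: rE; rewrite g0 !powR0 ?gt_eqF// add0r => /eqP.
by rewrite lt_eqF// powR_gt0.
Qed.

Lemma step_eq t : gam t.+2 `^ p = gam t.+2 `^ (p - 1) + gam t.+1 `^ p.
Proof. by have [[]] := hgam.2 t.+1 isT. Qed.

(** The tangent inequality between consecutive terms [c], [r] of the sequence,
    after inserting the recurrence, reads [r^(p-1) <= p * r^(p-1) * (r - c)]. *)
Lemma step_increment t : gam t.+1 + p^-1 <= gam t.+2.
Proof.
set c := gam t.+1; set r := gam t.+2.
have c0 : 0 < c by exact: step_gt0.
have r0 : 0 < r by exact: step_gt0.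
have := powR_tangent hp (ltW c0) (ltW r0).
have -> : c `^ p = r `^ p - r `^ (p - 1) by rewrite [r `^ p]step_eq; ring.
have -> : r `^ p = r * r `^ (p - 1) by rewrite mulr_powRB1// ltW.
have q0 : 0 < r `^ (p - 1) by rewrite powR_gt0.
set q := r `^ (p - 1) in q0 * => H.
rewrite -(ler_pM2l (mulr_gt0 p0 q0)).
have -> : p * q * (c + p^-1) = p * c * q + q by field; rewrite gt_eqF.
by lra.
Qed.

Lemma step_ge t : t.+1%:R / p <= gam t.+1.
Proof.
elim: t => [|t IH]; first by rewrite hgam.1 ler_pdivrMr// mul1r ltW.
by rewrite (le_trans _ (step_increment t))// -natr1 mulrDl mul1r lerD2r.
Qed.

Lemma alpha_sumE M t : alpha_sum p M gam t.+1 = gam t.+1 `^ p / M.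
Proof.
elim: t => [|t IH] /=; first by rewrite add0r /alpha hgam.1 !powR1.
by rewrite -/(alpha_sum p M gam t.+1) IH /alpha step_eq; ring.
Qed.

End StepSequence.

(** * Uniform convexity up to the boundary *)

Section UniformConvexity.
Context {R : realType} {n : nat}.
Variables (N : 'rV[R]_n -> R) (Q : set 'rV[R]_n) (p mu : R).
Variable Psi : 'rV[R]_n -> R.
Hypotheses (hN : is_norm N) (p1 : 1 < p) (mu0 : 0 <= mu).
Hypothesis Qconvex : convex_set (Q : set (convex_lmodType 'rV[R]_n)).
Hypothesis hPsi : uniformly_convex N Q p mu Psi.
Implicit Types (x y w g : 'rV[R]_n) (s : R).

Let p0 : 0 < p. Proof. exact: lt_trans ltr01 p1. Qed.

Lemma interior_segment x w s : Q x -> (interior Q) w -> 0 < s <= 1 ->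
  (interior Q) (x + s *: (w - x)).
Proof.
move=> Qx /nbhs_ballP[r /= r0 rQ] /andP[s0 s1].
apply/nbhs_ballP; exists (s * r); first by rewrite /= mulr_gt0.
move=> v; rewrite -ball_normE /= => vr.
have -> : v = x + s *: (x + s^-1 *: (v - x) - x).
  by apply/rowP => i; rewrite !mxE; field; rewrite gt_eqF.
apply: segment_in => //; last by rewrite (ltW s0).
apply: rQ; rewrite -ball_normE /=.
have -> : w - (x + s^-1 *: (v - x)) = s^-1 *: (x + s *: (w - x) - v).
  by apply/rowP => i; rewrite !mxE; field; rewrite gt_eqF.
by rewrite normrZ gtr0_norm ?invr_gt0// -ltr_pdivlMl ?invr_gt0// invrK.
Qed.

Lemma le_vanishing (a b K : R) :
  (forall s, 0 < s < 1 -> a <= b + s * K) -> a <= b.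
Proof.
move=> h; apply/ler_addgt0Pr => e e0.
pose s := Num.min 2^-1 (e / (`|K| + 1)).
have K0 : 0 < `|K| + 1 by rewrite ltr_wpDl.
have s0 : 0 < s by rewrite lt_min invr_gt0 ltr0n divr_gt0.
have s1 : s < 1 by rewrite gt_min; apply/orP; left; lra.
have se : s * (`|K| + 1) <= e by rewrite -ler_pdivlMr// ge_min lexx orbT.
have : a <= b + s * K by apply: h; rewrite s0.
have : s * K <= s * `|K| by rewrite ler_wpM2l ?ler_norm// ltW.
lra.
Qed.

(** At the intermediate point, the subgradient inequality towards [x] and the
    uniform one towards [y] are added with weights [1 - s] and [s], for which
    the subgradient cancels. *)
Lemma uniformly_convex_chord x y w s : Q x -> Q y -> 0 <= s <= 1 ->
  (interior Q) (x + s *: (y - x)) ->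
  Psi (x + s *: (y - x)) + s * (mu / p * ((1 - s) * N (y - x)) `^ p)
  <= Psi x + s * (Psi y - Psi x).
Proof.
move=> Qx Qy /andP[s0 s1]; set v := x + s *: (y - x) => Qv.
have [g gv] := hPsi.1 v Qv.
have := hPsi.2 v g y Qv gv Qy; have := gv x Qx.
have -> : x - v = - s *: (y - x).
  by apply/rowP => i; rewrite /v !mxE; ring.
have -> : y - v = (1 - s) *: (y - x).
  by apply/rowP => i; rewrite /v !mxE; ring.
rewrite !dotpZr (norm_scale hN) ger0_norm ?subr_ge0// => h1 h2.
have {}h1 := ler_wpM2l (_ : 0 <= 1 - s) h1.
have {}h2 := ler_wpM2l s0 h2.
by move: h1 h2; rewrite subr_ge0 s1 => /(_ isT); lra.
Qed.

(** The definition only speaks of interior points, whereas the iterates may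
    lie on the boundary. If [y] is interior, all points of the open segment
    are, and the chord inequality gives the claim as the point where it is
    taken tends to [x]. *)
Lemma uniformly_convex_to_interior x g y : Q x -> subgradient Q Psi x g ->
  (interior Q) y ->
  Psi x + dotp g (y - x) + mu / p * N (y - x) `^ p <= Psi y.
Proof.
move=> Qx gx Qy; have Qy' : Q y by exact: interior_subset.
apply: (@le_vanishing _ _ (mu * N (y - x) `^ p)) => s /andP[s0 s1].
have s01 : 0 <= s <= 1 by rewrite !ltW.
have Qv : (interior Q) (x + s *: (y - x)).
  by apply: interior_segment => //; rewrite s0 ltW.
have := uniformly_convex_chord x Qx Qy' s01 Qv.
have := gx _ (interior_subset Qv); rewrite addrAC subrr add0r dotpZr.
rewrite powRM ?normN_ge0 ?subr_ge0 ?(ltW s1)//.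
have t1 : 1 - p * s <= (1 - s) `^ p.
  have := @powR_tangent _ p (1 - s) 1 p1; rewrite !powR1; lra.
set r := N _ `^ p; have r0 : 0 <= mu / p * r.
  by rewrite mulr_ge0 ?powR_ge0// divr_ge0// ltW.
have := ler_wpM2l r0 t1.
have -> : mu / p * r * (1 - p * s) = mu / p * r - s * (mu * r).
  by field; rewrite gt_eqF.
move=> h1 h2 h3; rewrite -(ler_pM2l s0).
have {}h1 := ler_wpM2l (ltW s0) h1.
lra.
Qed.

(** A boundary point [y] is approached along the segment to an interior point
    [w], where the previous lemma applies. The chord inequality bounds the
    values of [Psi] there and so stands in for continuity at [y]. *)
Lemma uniformly_convex_boundary x g y w : (interior Q) w ->
  Q x -> subgradient Q Psi x g -> Q y ->
  Psi x + dotp g (y - x) + mu / p * N (y - x) `^ p <= Psi y.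
Proof.
move=> Qw Qx gx Qy; set r := N (y - x); set b := N (y - w).
apply: (@le_vanishing _ _ (Psi w - Psi y - dotp g (w - y)
  + mu * r `^ (p - 1) * b)) => s /andP[s0 s1].
have s01 : 0 <= s <= 1 by rewrite !ltW.
set v := y + s *: (w - y).
have Qv : (interior Q) v by apply: interior_segment => //; rewrite s0 ltW.
have h1 := uniformly_convex_to_interior Qx gx Qv.
have h2 := uniformly_convex_chord x Qy (interior_subset Qw) s01 Qv.
have h3 : r - s * b <= N (v - x).
  have -> : r = N ((v - x) + s *: (y - w)).
    by congr N; apply/rowP => i; rewrite /v !mxE; ring.
  rewrite lerBlDr (le_trans (norm_triangle hN _ _))//.
  by rewrite (norm_scale hN) gtr0_norm.
have h4 := powR_tangent p1 (normN_ge0 hN (v - x)) (normN_ge0 hN (y - x)).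
rewrite -/r in h4.
have q0 : 0 <= p * r `^ (p - 1) by rewrite mulr_ge0 ?powR_ge0// ltW.
have h5 := ler_wpM2l q0 h3.
have h6 : p * r `^ (p - 1) * r = p * r `^ p.
  by rewrite -mulrA [_ * r]mulrC mulr_powRB1// normN_ge0.
have m0 : 0 <= mu / p by rewrite divr_ge0// ltW.
have h7 : r `^ p - s * p * r `^ (p - 1) * b <= N (v - x) `^ p by lra.
have {}h7 := ler_wpM2l m0 h7.
have h8 : mu / p * (s * p * r `^ (p - 1) * b) = s * (mu * r `^ (p - 1) * b).
  by field; rewrite gt_eqF.
have h9 : 0 <= s * (mu / p * ((1 - s) * N (w - y)) `^ p).
  by rewrite mulr_ge0 ?(ltW s0)// mulr_ge0 ?powR_ge0.
have h10 : dotp g (v - x) = dotp g (y - x) + s * dotp g (w - y).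
  by rewrite -dotpZr -dotpDr addrAC.
move: h1 h2; rewrite h10 -/v.
lra.
Qed.

End UniformConvexity.

(** * One step and the rate of the accelerated method *)

Section Weights.
Context {R : realType}.
Variables (p M : R) (gam : nat -> R).
Hypotheses (p1 : 1 < p) (M0 : 0 < M) (hgam : step_sequence p gam).

Lemma alpha_gt0 t : 0 < alpha p M gam t.+1.
Proof. by rewrite divr_gt0// powR_gt0// (step_gt0 p1 hgam). Qed.

Lemma alpha_sum_ge0 t : 0 <= alpha_sum p M gam t.
Proof. by elim: t => //= t IH; rewrite addr_ge0// ltW// alpha_gt0. Qed.

Lemma alpha_sum_gt0 t : 0 < alpha_sum p M gam t.+1.
Proof. by rewrite /= ltr_wpDl ?alpha_sum_ge0 ?alpha_gt0. Qed.

Lemma tauE t : tau p M gam t = (gam t.+1)^-1.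
Proof.
have g0 := step_gt0 p1 hgam t.
rewrite /tau (alpha_sumE hgam) /alpha.
rewrite -(@mulr_powRB1 _ (gam t.+1) p) ?(ltW g0)//.
  by field; rewrite !gt_eqF// powR_gt0.
exact: lt_trans ltr01 p1.
Qed.

Lemma alpha_sum_tau t :
  alpha_sum p M gam t.+1 * tau p M gam t = alpha p M gam t.+1.
Proof. by rewrite /tau mulrC divfK// gt_eqF// alpha_sum_gt0. Qed.

Lemma tau01 t : 0 < tau p M gam t <= 1.
Proof.
rewrite divr_gt0 ?alpha_gt0 ?alpha_sum_gt0//=.
by rewrite ler_pdivrMr ?alpha_sum_gt0// mul1r /= lerDr alpha_sum_ge0.
Qed.

(** The recurrence of the step sequence is designed for this cancellation: it
    lets one Bregman term absorb the [p]-th power of the gradient step. *)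
Lemma alpha_sum_tau_powR t :
  alpha_sum p M gam t.+1 * (M * tau p M gam t `^ p) = 1.
Proof.
have g0 := step_gt0 p1 hgam t.
rewrite tauE (alpha_sumE hgam).
have -> : (gam t.+1)^-1 `^ p = (gam t.+1 `^ p)^-1.
  by rewrite -(powR_inv1 (ltW g0)) -powRrM mulN1r powRN.
by field; rewrite !gt_eqF// powR_gt0.
Qed.

End Weights.

Section Method.
Context {R : realType} {n : nat}.
Variables (N : 'rV[R]_n -> R) (Q : set 'rV[R]_n) (p M delta : R).
Variables (gam : nat -> R) (f : 'rV[R]_n -> R) (df : 'rV[R]_n -> 'rV[R]_n).
Variable Psi : 'rV[R]_n -> R.
Hypotheses (hN : is_norm N) (p1 : 1 < p) (M0 : 0 < M) (delta0 : 0 <= delta).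
Hypothesis hgam : step_sequence p gam.
Hypothesis Qconvex : convex_set (Q : set (convex_lmodType 'rV[R]_n)).
Hypothesis f_lower : forall x u, Q x -> Q u -> f x + dotp (df x) (u - x) <= f u.
Hypothesis f_upper : forall x u, Q x -> Q u ->
  f u <= f x + dotp (df x) (u - x) + (M / p * N (u - x) `^ p + delta / 2).
Hypothesis Psi_lower : forall x g u, Q x -> subgradient Q Psi x g -> Q u ->
  N (u - x) `^ p / p <= bregman Psi g x u.

Local Notation A := (alpha_sum p M gam).
Local Notation al := (alpha p M gam).
Local Notation ta := (tau p M gam).

Let p0 : 0 < p. Proof. exact: lt_trans ltr01 p1. Qed.

(** The gradient step is compared with the trial point
    [w = ta t *: z' + (1 - ta t) *: y], which differs from [x] by
    [ta t *: (z' - z)]. Multiplied by the weight [A t.+1], the power term of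
    [w] becomes [N (z' - z)^p / p], which the Bregman divergence dominates,
    and the linear term splits into one towards [y], bounded by convexity of
    [f], and one towards [z'], left for the mirror step. *)
Lemma accelerated_step t x y z y' z' g u :
  Q y -> Q z -> Q z' -> Q u -> subgradient Q Psi z g ->
  x = ta t *: z + (1 - ta t) *: y ->
  is_argmin Q (fun u => M / p * N (u - x) `^ p + dotp (df x) (u - x)) y' ->
  A t.+1 * f y' <= A t * f y + al t.+1 * f u + A t.+1 * (delta / 2)
    + (bregman Psi g z z' + al t.+1 * dotp (df x) (z' - u)).
Proof.
move=> Qy Qz Qz' Qu gz xE [Qy' y'min].
have /andP[ta0 ta1] := tau01 p1 M0 hgam t.
have A0 := alpha_sum_gt0 p1 M0 hgam t.
have At0 := alpha_sum_ge0 p1 M0 hgam t.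
have a0 := alpha_gt0 p1 M0 hgam t.
have AT := alpha_sum_tau p1 M0 hgam t.
have AP := alpha_sum_tau_powR p1 M0 hgam t.
have AS : A t.+1 = A t + al t.+1 by [].
have ta01 : 0 <= ta t <= 1 by rewrite ltW.
have Qx : Q x.
  have := segment_in Qconvex Qy Qz ta01; congr Q.
  by rewrite xE; apply/rowP => i; rewrite !mxE; ring.
pose w := x + ta t *: (z' - z).
have Qw : Q w.
  have := segment_in Qconvex Qy Qz' ta01; congr Q.
  by rewrite /w xE; apply/rowP => i; rewrite !mxE; ring.
have H1 := y'min w Qw; have H2 := f_upper Qx Qy'.
have Nw : N (w - x) = ta t * N (z' - z).
  by rewrite /w addrAC subrr add0r (norm_scale hN) gtr0_norm.
have Dw : dotp (df x) (w - x)
    = ta t * dotp (df x) (z' - x) + (1 - ta t) * dotp (df x) (y - x).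
  rewrite -!dotpZr -dotpDr; congr dotp.
  by rewrite /w xE; apply/rowP => i; rewrite !mxE; ring.
have H3 := Psi_lower Qz gz Qz'.
have H4 := f_lower Qx Qy; have H5 := f_lower Qx Qu.
have D5 : dotp (df x) (z' - u) = dotp (df x) (z' - x) - dotp (df x) (u - x).
  by rewrite -dotpNr -dotpDr opprB addrA subrK.
rewrite Nw Dw powRM ?(normN_ge0 hN) ?(ltW ta0)// in H1.
rewrite D5.
have {H1 H2} H : f y' <= f x + (M / p * (ta t `^ p * N (z' - z) `^ p)
    + (ta t * dotp (df x) (z' - x) + (1 - ta t) * dotp (df x) (y - x)))
    + delta / 2 by lra.
have {}H := ler_wpM2l (ltW A0) H.
have E1 : A t.+1 * (M / p * (ta t `^ p * N (z' - z) `^ p))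
    = N (z' - z) `^ p / p.
  transitivity (A t.+1 * (M * ta t `^ p) * (N (z' - z) `^ p / p)).
    by ring.
  by rewrite AP mul1r.
have E2 d : A t.+1 * (ta t * d) = al t.+1 * d by rewrite mulrA AT.
have E3 d : A t.+1 * ((1 - ta t) * d) = A t * d.
  by rewrite mulrA mulrBr AT AS; ring.
rewrite !(mulrDr (A t.+1)) E1 E2 E3 in H.
have {}H4 := ler_wpM2l At0 H4; have {}H5 := ler_wpM2l (ltW a0) H5.
have E4 : A t.+1 * f x = A t * f x + al t.+1 * f x by rewrite AS mulrDl.
by rewrite E4 in H; lra.
Qed.

(** The Bregman divergences to a fixed [u] telescope along the run: the
    optimality condition at [z t.+1] gives the three-point inequality. The last
    mirror step has no subgradient attached, so there only the minimality of
    [z T] is used and the final divergence is dropped. *)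
Lemma accelerated_rate T x0 g0 x y z g u :
  (0 < T)%N -> Q x0 -> Q u ->
  accelerated_run N Q p M gam df Psi T x0 g0 x y z g ->
  A T * (f (y T) - f u) <= bregman Psi g0 x0 u + T%:R * A T * (delta / 2).
Proof.
move=> T0 Qx0 Qu [y0 z0 g00 hg hx hy hz hopt].
have Qyz t : (t <= T)%N -> Q (y t) /\ Q (z t).
  case: t => [|t] tT; first by rewrite y0 z0.
  by have [] := hy t tT; have [] := hz t tT.
have step t : (t < T)%N -> A t.+1 * f (y t.+1) <=
    A t * f (y t) + al t.+1 * f u + A t.+1 * (delta / 2)
    + (bregman Psi (g t) (z t) (z t.+1)
       + al t.+1 * dotp (df (x t.+1)) (z t.+1 - u)).
  move=> tT; have [Qy Qz] := Qyz t (ltnW tT); have [_ Qz'] := Qyz t.+1 tT.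
  exact: (accelerated_step Qy Qz Qz' Qu (hg t tT) (hx t tT) (hy t tT)).
have err t : A t.+1 * (delta / 2) + t%:R * A t * (delta / 2)
    <= t.+1%:R * A t.+1 * (delta / 2).
  rewrite -mulrDl ler_wpM2r ?divr_ge0// -natr1 mulrDl mul1r addrC lerD2r.
  by rewrite ler_wpM2l// lerDl ltW// alpha_gt0.
have inv t : (t < T)%N -> A t * f (y t) <= A t * f u
    + bregman Psi g0 x0 u - bregman Psi (g t) (z t) u
    + t%:R * A t * (delta / 2).
  elim: t => [_|t IH tT]; first by rewrite z0 g00 /= !mul0r; lra.
  have tT' := ltnW tT; have h1 := IH tT'; have h2 := step t tT'.
  have h3 := err t.
  have h4 := hopt t tT u Qu.
  (* the three-point identity for Bregman divergences *)
  have h5 : bregman Psi (g t) (z t) (z t.+1)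
      + al t.+1 * dotp (df (x t.+1)) (z t.+1 - u)
      <= bregman Psi (g t) (z t) u - bregman Psi (g t.+1) (z t.+1) u.
    move: h4; rewrite /bregman dotpDl dotpZl dotpDl dotpNl.
    rewrite !(dotpDr, dotpNr); lra.
  have h6 : A t.+1 * f u = A t * f u + al t.+1 * f u by rewrite /= mulrDl.
  lra.
case: T T0 hz step inv {Qyz hg hx hy hopt} => // t _ hz step inv.
have h1 := inv t (leqnn _); have h2 := step t (leqnn _); have h3 := err t.
have [_ h4] := hz t (leqnn _); have {}h4 := h4 u Qu.
have h5 : bregman Psi (g t) (z t) (z t.+1)
    + al t.+1 * dotp (df (x t.+1)) (z t.+1 - u) <= bregman Psi (g t) (z t) u.
  by move: h4; rewrite !(dotpDr, dotpNr); lra.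
have h6 : A t.+1 * f u = A t * f u + al t.+1 * f u by rewrite /= mulrDl.
by rewrite mulrBr; lra.
Qed.

End Method.

(** * The number of iterations *)

Section IterationCount.
Context {R : realType}.
Implicit Types p sigma L eps V : R.

(** For [p = sigma] this is the convention [0^0 = 1]. *)
Lemma self_power_gt0 p sigma : 0 < sigma <= p ->
  0 < ((p - sigma) / sigma) `^ (p - sigma).
Proof.
move=> /andP[s0]; rewrite le_eqVlt => /predU1P[<-|sp].
  by rewrite subrr powRr0.
by rewrite powR_gt0// divr_gt0// subr_gt0.
Qed.

(** Both sides are products of powers, so the claim is affine in the logarithms
    of the parameters: the iteration count is the solution of the equality
    case. *)
Lemma iteration_count p sigma L eps V (T : nat) :
  2 <= p -> 1 < sigma <= 2 -> 0 < L -> 0 < eps -> 0 < V -> (0 < T)%N ->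
  p * (2 `^ p * ((p - sigma) / sigma) `^ (p - sigma)
       * (V `^ sigma * (L `^ p / eps `^ p))) `^ (1 / ((p + 1) * sigma - p))
    <= T%:R ->
  prox_parameter p sigma L (eps / T%:R) * V <= eps / 2 * (T%:R / p) `^ p.
Proof.
move=> p2 /andP[s1 s2] L0 e0 V0 T0; rewrite -(ltr0n R) in T0.
set t := T%:R in T0 *; have p0 : 0 < p by lra. have s0 : 0 < sigma by lra.
have sp : 0 < sigma <= p by lra.
have q0 : 0 < (p + 1) * sigma - p.
  by have := mulr_gt0 (_ : 0 < p) (_ : 0 < sigma - 1); rewrite subr_gt0; lra.
set q := (p + 1) * sigma - p in q0 *.
have K0 := self_power_gt0 sp; set k := (p - sigma) / sigma in K0 *.
have lnK : ln (k `^ (p - sigma)) = (p - sigma) * ln k by rewrite ln_powR.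
move: (k `^ (p - sigma)) K0 lnK => K K0 lnK.
have X0 : 0 < 2 `^ p * K * (V `^ sigma * (L `^ p / eps `^ p)).
  by apply: mulr_gt0; apply: mulr_gt0; rewrite ?divr_gt0 ?powR_gt0.
have d0 : 0 < eps / t by rewrite divr_gt0.
have M0 := prox_parameter_gt0 L0 d0 p0 sp.
have lnM' : ln (prox_parameter p sigma L (eps / t))
    = k * (ln 2 - ln p + ln k - (ln eps - ln t)) + p / sigma * ln L.
  move: M0; rewrite /prox_parameter -/k => M0.
  have F0 : 0 < (2 / p * k * (1 / (eps / t))) `^ k.
    by move: M0; rewrite pmulr_lgt0// powR_gt0.
  rewrite lnM ?posrE ?(powR_gt0 _ L0)// !ln_powR; congr (_ + _).
  (* For [p = sigma] the base of the power contains the vanishing [k]; its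
     logarithm is then multiplied by [k = 0]. *)
  have [->|kn0] := eqVneq k 0; first by rewrite !mul0r.
  have k0 : 0 < k.
    rewrite lt_neqAle eq_sym kn0 /k divr_ge0 ?(ltW s0)// subr_ge0.
    by case/andP: sp.
  have h1 : 0 < 2 / p by rewrite divr_gt0.
  have h2 : 0 < 2 / p * k by rewrite mulr_gt0.
  rewrite div1r lnM ?posrE ?invr_gt0// lnM ?posrE// lnV ?posrE//.
  by rewrite (@ln_div _ 2 p) ?posrE// (@ln_div _ eps t) ?posrE.
move: (prox_parameter p sigma L (eps / t)) M0 lnM' => M M0 lnM'.
have X1 : 0 < 2 `^ p * K by rewrite mulr_gt0 ?powR_gt0.
have X2 : 0 < L `^ p / eps `^ p by rewrite divr_gt0 ?powR_gt0.
have X3 : 0 < V `^ sigma * (L `^ p / eps `^ p) by rewrite mulr_gt0 ?powR_gt0.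
rewrite -ler_ln ?posrE ?mulr_gt0 ?powR_gt0//.
rewrite lnM ?posrE ?powR_gt0// ln_powR.
rewrite lnM ?posrE// lnM ?posrE ?powR_gt0// lnM ?posrE ?powR_gt0//.
rewrite ln_div ?posrE ?powR_gt0// !ln_powR lnK => H.
rewrite -ler_ln ?posrE ?mulr_gt0 ?invr_gt0 ?powR_gt0 ?divr_gt0//.
rewrite [leLHS]lnM ?posrE// [leRHS]lnM ?posrE ?divr_gt0 ?powR_gt0 ?divr_gt0//.
rewrite ln_powR !ln_div ?posrE// lnM'.
move: H; rewrite -(ler_pM2l q0) -subr_ge0 => H.
rewrite -(ler_pM2l s0) -subr_ge0.
suff -> : sigma * (ln eps - ln 2 + p * (ln t - ln p))
  - sigma * (k * (ln 2 - ln p + ln k - (ln eps - ln t)) + p / sigma * ln L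
             + ln V)
  = q * ln t - q * (ln p + 1 / q * (p * ln 2 + (p - sigma) * ln k
      + (sigma * ln V + (p * ln L - p * ln eps)))) by [].
have kE : sigma * k = p - sigma by rewrite /k; field; rewrite gt_eqF.
have pE : sigma * (p / sigma) = p by field; rewrite gt_eqF.
have -> c : q * (ln p + 1 / q * c) = q * ln p + c by field; rewrite gt_eqF.
rewrite mulrBr mulrDr (mulrDr sigma _ (ln V)) (mulrDr sigma (k * _)).
by rewrite (mulrA sigma k) kE (mulrA sigma (p / sigma)) pE /q; ring.
Qed.

Lemma exists_nat_ceil (B : R) : 0 < B ->
  exists T : nat, [/\ (0 < T)%N, B <= T%:R & T%:R < B + 1].
Proof.
move=> B0; have /andP[b1 b2] := Num.Theory.truncn_itv (ltW B0).
have [bE|bn] := eqVneq (Num.truncn B)%:R B.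
  exists (Num.truncn B); rewrite -(ltr0n R) bE B0 lexx; split=> //.
  by rewrite ltrDl.
exists (Num.truncn B).+1; split=> //; first exact: ltW.
by rewrite -natr1 ltrD2r lt_neqAle bn.
Qed.

End IterationCount.

Section Variation.
Context {R : realType} {n : nat}.
Variables (N : 'rV[R]_n -> R) (Q : set 'rV[R]_n) (p mu : R).
Variable Psi : 'rV[R]_n -> R.

(** Along a line through an interior point, [Psi] rises strictly in the
    direction where its subgradient is nonnegative. *)
Lemma variation_constant_gt0 w : (0 < n)%N -> is_norm N -> 0 < mu -> 0 < p ->
  uniformly_convex N Q p mu Psi -> (interior Q) w ->
  (0 < variation_constant Q Psi)%E.
Proof.
move=> n0 hN mu0 p0 hPsi Qw; have [r /= r0 rQ] := (nbhs_ballP _ _).1 Qw.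
have [g gw] := hPsi.1 w Qw.
pose e : 'rV[R]_n := const_mx 1.
have e0 : e != 0.
  apply/eqP => /rowP /(_ (Ordinal n0)); rewrite !mxE => /eqP.
  by rewrite oner_eq0.
have ne : 0 < `|e| by rewrite normr_gt0.
pose v := (r / 2 / `|e|) *: e.
have s0 : 0 < r / 2 / `|e| by rewrite !divr_gt0.
have nv : `|v| < r.
  by rewrite normrZ gtr0_norm// divfK ?gt_eqF//; lra.
have v0 : v != 0 by rewrite scaler_eq0 negb_or gt_eqF.
have [v' [v'0 nv' gv']] : exists v', [/\ v' != 0, `|v'| < r & 0 <= dotp g v'].
  have [gv|gv] := leP 0 (dotp g v); first by exists v.
  by exists (- v); rewrite oppr_eq0 normrN dotpNr oppr_ge0 ltW.
have Qv : Q (w + v').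
  by apply: rQ; rewrite -ball_normE /= opprD addrA subrr add0r normrN.
have := hPsi.2 w g (w + v') Qw gw Qv.
rewrite [in dotp _ _](addrC w) [in N _](addrC w) addrK => H.
have Nv : 0 < mu / p * N v' `^ p.
  by rewrite mulr_gt0 ?divr_gt0// powR_gt0// normN_gt0.
have up : ((Psi (w + v'))%:E <= ereal_sup [set (Psi x)%:E | x in Q])%E.
  by apply: ereal_sup_ubound; exists (w + v').
have dn : (ereal_inf [set (Psi x)%:E | x in Q] <= (Psi w)%:E)%E.
  by apply: ereal_inf_lbound; exists w => //; exact: interior_subset.
rewrite /variation_constant; apply: lt_le_trans (leeB up dn).
by rewrite -EFinB lte_fin; lra.
Qed.

End Variation.

Theorem corollary4p10 (R : realType) (n : nat) (hn : (0 < n)%N)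
    (p sigma : R) (hp : 2 <= p) (hsigma : 1 < sigma <= 2)
    (N : 'rV[R]_n -> R) (hN : is_norm N)
    (Q : set 'rV[R]_n) (hQcompact : compact Q)
    (hQconvex : convex_set (Q : set (convex_lmodType 'rV[R]_n)))
    (hQ0 : Q^° 0)
    (L : R) (hL : 0 < L)
    (f : 'rV[R]_n -> R) (df : 'rV[R]_n -> 'rV[R]_n)
    (hf : holder_class N Q sigma L f df)
    (Psi : 'rV[R]_n -> R) (hPsi : uniformly_convex N Q p 1 Psi)
    (gam : nat -> R) (hgam : step_sequence p gam)
    (x0 g0 : 'rV[R]_n) (hx0 : Q x0) (hg0 : subgradient Q Psi x0 g0)
    (hV0 : forall u, Q u -> ((bregman Psi g0 x0 u)%:E <= variation_constant Q Psi)%E)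
    (eps : R) (heps : 0 < eps) :
  exists T : nat,
    [/\ (0 < T)%N,
        (T%:R%:E < iteration_bound p sigma L eps (variation_constant Q Psi))%E &
        forall x y z g : nat -> 'rV[R]_n,
          accelerated_run N Q p (prox_parameter p sigma L (eps / T%:R)) gam
            df Psi T x0 g0 x y z g ->
          f (y T) - inf (f @` Q) <= eps].
Proof.
have p0 : 0 < p by lra. have p1 : 1 < p by lra.
have /andP[s1 s2] := hsigma.
have s0 : 0 < sigma by lra. have sp : 0 < sigma <= p by lra.
have [fconv fdf _] := hf.
have Q0 : Q !=set0 by exists x0.
have [u /[!inE] Qu umin] :=
  EVT_min_rV Q0 hQcompact (gradient_continuous fdf).
have D0 : (0 < variation_constant Q Psi)%E.
  exact: variation_constant_gt0 hn hN ltr01 p0 hPsi hQ0.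
have K0 := self_power_gt0 sp.
have X0 : 0 < L `^ p / eps `^ p by rewrite divr_gt0 ?powR_gt0.
have c0 : 0 < 2 `^ p * ((p - sigma) / sigma) `^ (p - sigma).
  by rewrite mulr_gt0 ?K0 ?powR_gt0.
pose B V := p * (2 `^ p * ((p - sigma) / sigma) `^ (p - sigma)
  * (V `^ sigma * (L `^ p / eps `^ p))) `^ (1 / ((p + 1) * sigma - p)).
(* If the variation of [Psi] is infinite, the bound is infinite, and any real
   upper bound of the initial divergence to the minimizer serves instead. *)
have [V [V0 uV VB]] : exists V, [/\ 0 < V, bregman Psi g0 x0 u <= V &
    forall t : R, t < B V + 1 ->
      (t%:E < iteration_bound p sigma L eps (variation_constant Q Psi))%E].
  have := hV0 u Qu; move: D0.
  case: (variation_constant Q Psi) => [D| |]; last by rewrite ltNge leNye.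
    by move=> D0 uD; exists D.
  move=> _ _; exists (`|bregman Psi g0 x0 u| + 1); split.
  - by rewrite ltr_wpDl.
  - by rewrite (le_trans (ler_norm _))// lerDl.
  - move=> t _; rewrite /iteration_bound poweRyr ?gt_eqF//.
    rewrite gt0_mulye ?lte_fin// gt0_muley ?lte_fin//.
    rewrite poweRyr; last first.
      rewrite gt_eqF// divr_gt0//.
      by have := mulr_gt0 p0 (_ : 0 < sigma - 1); rewrite subr_gt0; lra.
    by rewrite gt0_muley ?lte_fin// addye// ltry.
have B0 : 0 < B V.
  by rewrite mulr_gt0// powR_gt0// mulr_gt0// mulr_gt0// powR_gt0.
have [T [T0 BT TB]] := exists_nat_ceil B0.
exists T; split=> //; first exact: VB.
move=> x y z g run.
have TR : 0 < T%:R :> R by rewrite ltr0n.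
have d0 : 0 < eps / T%:R by rewrite divr_gt0.
have M0 := prox_parameter_gt0 hL d0 p0 sp.
have hT := iteration_count hp hsigma hL heps V0 T0 BT.
set M := prox_parameter _ _ _ _ in M0 hT run *.
have f_lower x' v : Q x' -> Q v -> f x' + dotp (df x') (v - x') <= f v.
  exact: gradient_le.
have f_upper x' v : Q x' -> Q v -> f v <= f x' + dotp (df x') (v - x')
    + (M / p * N (v - x') `^ p + eps / T%:R / 2).
  move=> Qx' Qv.
  rewrite (le_trans (holder_upper_bound hN hQconvex s1 hL hf Qx' Qv))// lerD2l.
  by apply: holder_le_prox => //; exact: normN_ge0.
have Psi_lower x' g' v : Q x' -> subgradient Q Psi x' g' -> Q v ->
    N (v - x') `^ p / p <= bregman Psi g' x' v.
  move=> Qx' gx' Qv.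
  have := uniformly_convex_boundary hN p1 ler01 hQconvex hPsi hQ0 Qx' gx' Qv.
  by rewrite /bregman; lra.
have rate := accelerated_rate hN p1 M0 (ltW d0) hgam hQconvex
  f_lower f_upper Psi_lower T0 hx0 Qu run.
have gT : T%:R / p <= gam T.
  by rewrite -(prednK T0); exact: step_ge p1 hgam _.
have gT0 : 0 < T%:R / p by rewrite divr_gt0.
have AT : V <= eps / 2 * alpha_sum p M gam T.
  rewrite -(prednK T0) (alpha_sumE hgam) (prednK T0).
  rewrite mulrA ler_pdivlMr// mulrC (le_trans hT)//.
  rewrite ler_wpM2l ?divr_ge0 ?(ltW heps)// ge0_ler_powR ?(ltW p0)//.
    by rewrite nnegrE ltW.
  by rewrite nnegrE (le_trans (ltW gT0)).
have A0 : 0 < alpha_sum p M gam T.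
  by rewrite -(pmulr_rgt0 _ (_ : 0 < eps / 2)) ?divr_gt0// (lt_le_trans V0).
have fu : f (y T) - f u <= eps.
  rewrite -(ler_pM2l A0) (le_trans rate)//.
  have -> : T%:R * alpha_sum p M gam T * (eps / T%:R / 2)
    = eps / 2 * alpha_sum p M gam T by field; rewrite gt_eqF.
  lra.
have : f u <= inf (f @` Q).
  apply: lb_le_inf; first by exists (f u), u.
  by move=> _ [v Qv <-]; apply: umin; rewrite inE.
lra.
Qed.
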